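(* Let $(R,\mathfrak{m})$ be a commutative noetherian local ring with $\dim(R)\le 1$, and let $M$ be a separated $R$-module with $\mathfrak{m}$-adic completion $\hat M$. Then $\operatorname{Ass}(\hat M)=\operatorname{Koatt}(M)$.
   Context: An $R$-module $M$ is separated if $\bigcap_{n\ge 1}\mathfrak{m}^nM=0$. $\hat M=\varprojlim M/\mathfrak{m}^nM$. $\operatorname{Ass}(\hat M)$ is the set of primes of $R$ associated to $\hat M$ as an $R$-module. A prime $\mathfrak{p}\in\operatorname{Spec}(R)$ is coattached to $M$ if there is a submodule $U\subset M$ with $\mathfrak{p}=\operatorname{Ann}_R(U)$; $\operatorname{Koatt}(M)$ denotes the set of coattached primes of $M$. Modules need not be finitely generated. *)

(* Defs.v *)
From HB Require Import structures.
From mathcomp Require Import all_boot all_order all_algebra.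
From mathcomp Require Import ring_quotient generic_quotient.
From mathcomp Require Import boolp classical_sets.

Set Implicit Arguments.
Unset Strict Implicit.
Unset Printing Implicit Defensive.

Import GRing.Theory.
Local Open Scope classical_set_scope.
Local Open Scope ring_scope.
Local Open Scope quotient_scope.

Section Submodules.
Context {R : comNzRingType}.

Definition submodule {M : lmodType R} (U : set M) : Prop := submod_closed [in U].

(* Possibly the unit ideal; [R^o] is R as a module over itself. *)
Definition ideal (I : set R) : Prop := submodule (I : set R^o).

(* [idealr_closed] includes properness. *)
Definition prime_ideal (p : set R) : Prop :=
  idealr_closed [in p] /\ prime_idealr_closed [in p].

Definition maximal_ideal (m : set R) : Prop :=
  idealr_closed [in m] /\
  forall J : set R, idealr_closed [in J] -> m `<=` J -> J = m.

Definition ideal_mul (I J : set R) : set R :=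
  smallest ideal [set a * b | a in I & b in J].

Fixpoint ideal_exp (I : set R) (n : nat) : set R :=
  if n is n'.+1 then ideal_mul I (ideal_exp I n') else setT.

Definition ideal_scale (M : lmodType R) (I : set R) : set M :=
  smallest submodule [set a *: x | a in I & x in [set: M]].

Lemma submodule_smallest (M : lmodType R) (X : set M) :
  submodule (smallest submodule X).
Proof.
split; first by apply/mem_set => A [[A0 _] _]; apply/set_mem.
move=> a u v /set_mem su /set_mem sv; apply/mem_set => A AX.
have [[_ Alin] _] := AX.
by apply/set_mem; apply: Alin; apply/mem_set; [apply: su | apply: sv].
Qed.

Lemma ideal_mul_subr (I J : set R) : ideal J -> ideal_mul I J `<=` J.
Proof.
move=> idJ; apply: smallest_sub => // _ [a _ [b /mem_set Jb <-]].
have [J0 Jlin] := idJ.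
by apply/set_mem; have := Jlin a b 0 Jb J0; rewrite addr0.
Qed.

Lemma ideal_ideal_exp (I : set R) n : ideal (ideal_exp I n).
Proof.
case: n => [|n]; last exact: (@submodule_smallest R^o).
by split=> [|a u v _ _]; apply/mem_set.
Qed.

End Submodules.

Section QuotientModule.
Context {R : comNzRingType} {M : lmodType R} {U : set M} (sU : submodule U).

Definition submod_pred of submodule U : {pred M} := [in U].

HB.instance Definition _ :=
  GRing.isZmodClosed.Build M (submod_pred sU) (GRing.submod_closedB sU).

(* The library provides M/U as a [zmodType]; we add the action of R. *)
Local Notation Q := (Quotient.quot (submod_pred sU)).

Definition quot_scale (a : R) : Q -> Q := lift_op1 Q ( *:%R a).

Lemma pi_quot_scale a : {morph \pi_Q : x / a *: x >-> quot_scale a x}.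
Proof.
move=> x; unlock quot_scale; apply/eqP; rewrite -Quotient.idealrBE -scalerBr.
have [_ Z] := GRing.submod_closed_semi sU.
by apply: (Z a _ (_ : _ \in submod_pred sU)); rewrite Quotient.idealrBE reprK.
Qed.

Let quot_scalerA a b x : quot_scale a (quot_scale b x) = quot_scale (a * b) x.
Proof. by rewrite -[x]reprK -!pi_quot_scale scalerA. Qed.

Let quot_scale1r : left_id 1 quot_scale.
Proof. by move=> x; rewrite -[x]reprK -!pi_quot_scale scale1r. Qed.

Let quot_scalerDr : right_distributive quot_scale +%R.
Proof.
move=> a x y; rewrite -[x]reprK -[y]reprK.
by rewrite -[in LHS]raddfD -!pi_quot_scale scalerDr raddfD.
Qed.

Let quot_scalerDl x : {morph quot_scale^~ x : a b / a + b}.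
Proof.
by move=> a b; rewrite -[x]reprK -!pi_quot_scale scalerDl raddfD.
Qed.

HB.instance Definition _ := GRing.Zmodule_isLmodule.Build R Q
  quot_scalerA quot_scale1r quot_scalerDr quot_scalerDl.

End QuotientModule.

Section DependentProduct.
Variables (R : comNzRingType) (N : nat -> lmodType R).

Definition lmod_prod : Type := forall n, N n.

HB.instance Definition _ := gen_eqMixin lmod_prod.
HB.instance Definition _ := gen_choiceMixin lmod_prod.

Implicit Types x y z : lmod_prod.

Let lmod_prod_add x y : lmod_prod := fun n => x n + y n.
Let lmod_prod_opp x : lmod_prod := fun n => - x n.
Let lmod_prod_zero : lmod_prod := fun n => 0.
Let lmod_prod_scale (a : R) x : lmod_prod := fun n => a *: x n.

Let lmod_prod_addA : associative lmod_prod_add.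
Proof. by move=> x y z; apply: functional_extensionality_dep => n; apply: addrA. Qed.
Let lmod_prod_addC : commutative lmod_prod_add.
Proof. by move=> x y; apply: functional_extensionality_dep => n; apply: addrC. Qed.
Let lmod_prod_add0 : left_id lmod_prod_zero lmod_prod_add.
Proof. by move=> x; apply: functional_extensionality_dep => n; apply: add0r. Qed.
Let lmod_prod_addN : left_inverse lmod_prod_zero lmod_prod_opp lmod_prod_add.
Proof. by move=> x; apply: functional_extensionality_dep => n; apply: addNr. Qed.

HB.instance Definition _ :=
  GRing.isZmodule.Build lmod_prod lmod_prod_addA lmod_prod_addC lmod_prod_add0 lmod_prod_addN.

Let lmod_prod_scalerA a b x : lmod_prod_scale a (lmod_prod_scale b x) = lmod_prod_scale (a * b) x.
Proof. by apply: functional_extensionality_dep => n; apply: scalerA. Qed.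
Let lmod_prod_scale1r : left_id 1 lmod_prod_scale.
Proof. by move=> x; apply: functional_extensionality_dep => n; apply: scale1r. Qed.
Let lmod_prod_scalerDr : right_distributive lmod_prod_scale +%R.
Proof. by move=> a x y; apply: functional_extensionality_dep => n; apply: scalerDr. Qed.
Let lmod_prod_scalerDl x : {morph lmod_prod_scale^~ x : a b / a + b}.
Proof. by move=> a b; apply: functional_extensionality_dep => n; apply: scalerDl. Qed.

HB.instance Definition _ := GRing.Zmodule_isLmodule.Build R lmod_prod
  lmod_prod_scalerA lmod_prod_scale1r lmod_prod_scalerDr lmod_prod_scalerDl.

End DependentProduct.

Section Completion.
Context {R : comNzRingType} (I : set R) (M : lmodType R).

Definition adic_submod (n : nat) : set M := ideal_scale (ideal_exp I n).

Lemma adic_submodule n : submodule (adic_submod n).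
Proof. exact: submodule_smallest. Qed.

Local Notation Q n := (Quotient.quot (submod_pred (adic_submodule n))).

Definition adic_quot (n : nat) : lmodType R := Q n.

Definition adic_proj (n : nat) : M -> adic_quot n := \pi_(Q n).

Lemma adic_proj_is_linear n : linear (adic_proj n).
Proof.
move=> a x y; rewrite /adic_proj raddfD; congr (_ + _).
exact: pi_quot_scale.
Qed.

HB.instance Definition _ n :=
  GRing.isLinear.Build R M (adic_quot n) _ (adic_proj n) (adic_proj_is_linear n).

(* Independent of the representative: see [adic_transE]. *)
Definition adic_trans (n : nat) (y : adic_quot n.+1) : adic_quot n :=
  adic_proj n (repr (y : Q n.+1)).

Lemma adic_submodS n : adic_submod n.+1 `<=` adic_submod n.
Proof.
move=> x xS A [Asub AS]; apply: xS; split=> //.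
move=> _ [a Ia [y _ <-]]; apply: AS; exists a; last by exists y.
exact: ideal_mul_subr (ideal_ideal_exp I n) _ Ia.
Qed.

Lemma adic_transE n x : adic_trans (adic_proj n.+1 x) = adic_proj n x.
Proof.
rewrite /adic_trans /adic_proj; apply/eqP; rewrite -Quotient.idealrBE.
have xS : repr (\pi_(Q n.+1) x) - x \in submod_pred (adic_submodule n.+1).
  by rewrite Quotient.idealrBE reprK.
by apply/mem_set; apply: adic_submodS; apply: set_mem xS.
Qed.

Lemma adic_trans_is_linear n : linear (@adic_trans n).
Proof.
have projK k (y : adic_quot k) : adic_proj k (repr (y : Q k)) = y.
  by rewrite /adic_proj reprK.
move=> a u v; rewrite -[u]projK -[v]projK.
by rewrite -adic_proj_is_linear !adic_transE adic_proj_is_linear.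
Qed.

HB.instance Definition _ n :=
  GRing.isLinear.Build R (adic_quot n.+1) (adic_quot n) _ (@adic_trans n)
    (@adic_trans_is_linear n).

Definition coherent : {pred lmod_prod adic_quot} :=
  fun x => `[< forall n, adic_trans (x n.+1) = x n >].

Lemma coherent_closed : submod_closed coherent.
Proof.
split; first by apply/asboolP => n; apply: raddf0.
move=> a x y /asboolP cx /asboolP cy; apply/asboolP => n.
rewrite -[RHS]/(a *: x n + y n) -cx -cy.
exact: adic_trans_is_linear.
Qed.

HB.instance Definition _ :=
  GRing.isSubmodClosed.Build R (lmod_prod adic_quot) coherent coherent_closed.
HB.instance Definition _ := GRing.isZmodClosed.Build (lmod_prod adic_quot) coherent
  (GRing.submod_closedB coherent_closed).

(* The inverse limit of the M/I^n M, as a submodule of their product. *)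
Record completion : Type := Completion {
  completion_val :> lmod_prod adic_quot;
  _ : completion_val \in coherent
}.

HB.instance Definition _ := [isSub for completion_val].
HB.instance Definition _ := [Choice of completion by <:].
HB.instance Definition _ := [SubChoice_isSubLmodule of completion by <:].

Definition separated : Prop :=
  \bigcap_(n >= 1) adic_submod n = [set 0].

End Completion.

Definition annihilator {R : comNzRingType} {M : lmodType R} (U : set M) : set R :=
  [set a | forall x, U x -> a *: x = 0].

Definition Ass {R : comNzRingType} (M : lmodType R) : set (set R) :=
  [set p | prime_ideal p /\ exists x : M, p = annihilator [set x]].

(* The whole of M is allowed as U. *)
Definition Koatt {R : comNzRingType} (M : lmodType R) : set (set R) :=
  [set p | prime_ideal p /\ exists2 U : set M, submodule U & p = annihilator U].

Definition noetherian (R : comNzRingType) : Prop :=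
  forall I : set R, ideal I -> exists s : seq R, I = smallest ideal [set` s].

(* R is local with maximal ideal m: m is maximal, and no other ideal is. *)
Definition local_ring (R : comNzRingType) (m : set R) : Prop :=
  forall J : set R, maximal_ideal J <-> J = m.

(* Every chain [p 0] < ... < [p n] of primes has length [n <= d]. *)
Definition krull_dim_le (R : comNzRingType) (d : nat) : Prop :=
  forall (n : nat) (p : nat -> set R),
    (forall i, (i <= n)%N -> prime_ideal (p i)) ->
    (forall i, (i < n)%N -> p i `<` p i.+1) ->
    (n <= d)%N.

(* Main.v *)
Require Import Defs.
From mathcomp Require Import all_boot all_algebra.
From mathcomp Require Import ring_quotient generic_quotient ring.
From mathcomp Require Import boolp classical_sets.

Set Implicit Arguments.
Unset Strict Implicit.
Unset Printing Implicit Defensive.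

Import GRing.Theory.

(** Call [M'] the completion of [M].

    An element of [M'] is killed by everything that kills [M], so a prime [p]
    associated to [M'] contains the annihilator of [M]. Over any noetherian ring,
    such a [p] contains a coattached prime [P] of [M] ([coattached_below]). If
    [P] differs from [p], then [p = m] because the dimension is at most one, and
    the point is that [M] has nonzero [m]-torsion as soon as [M'] has some. There
    is an [a] in [m] lying in no other prime ([exists_parameter]), so a power of
    [m] lies in [(a)]. If [M] has no [m]-torsion, then [a] is injective on [M], and
    since the [m]-adic and [a]-adic filtrations are cofinal, [a] is also injective
    on [M'] ([torsionfree_completion]).

    Conversely let [p] be the annihilator of a submodule [U] of [M]. If [p = m],
    any nonzero element of [U] survives in [M'] by separatedness and has
    annihilator [m]. Otherwise fix [a] in [m] outside [p]. No power of [a] kills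
    [U], and a Baire-type construction ([nontorsion_partial_sums]) gives a limit
    [x] of elements of [U] killed by no power of [a]. The annihilator of [x]
    contains [p]; it cannot contain a [b] outside [p], since the only prime above
    [p + (b)] is [m], so that [p + (b)] contains a power of [a]. *)

Section CompletionPrimes.

Local Open Scope classical_set_scope.
Local Open Scope ring_scope.

(** * Submodules and ideals as sets *)

Section Submodules.
Variable R : comNzRingType.

Lemma submoduleP (M : lmodType R) (U : set M) :
  submodule U <-> U 0 /\ forall a u v, U u -> U v -> U (a *: u + v).
Proof.
rewrite /submodule; split=> -[U0 UL]; split; rewrite ?in_setE // in U0 *.
  by move=> a u v Uu Uv; apply/set_mem/UL; rewrite in_setE.
by move=> a u v; rewrite !in_setE; apply: UL.
Qed.

Section Closure.
Variables (M : lmodType R) (U : set M).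
Hypothesis sU : submodule U.

Lemma submodule0 : U 0. Proof. by case/submoduleP: sU. Qed.

Lemma submoduleL a u v : U u -> U v -> U (a *: u + v).
Proof. by case/submoduleP: sU => _; apply. Qed.

Lemma submoduleZ a u : U u -> U (a *: u).
Proof. by move=> Uu; rewrite -[_ *: _]addr0; apply/submoduleL/submodule0. Qed.

Lemma submoduleD u v : U u -> U v -> U (u + v).
Proof. by move=> Uu Uv; rewrite -[u]scale1r; apply: submoduleL. Qed.

Lemma submoduleB u v : U u -> U v -> U (u - v).
Proof.
by move=> Uu Uv; rewrite addrC -scaleN1r; apply: submoduleL.
Qed.

End Closure.

Lemma submodule_scale (M : lmodType R) (U : set M) s :
  submodule U -> submodule [set s *: u | u in U].
Proof.
move=> sU; apply/submoduleP; split.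
  by exists 0; rewrite ?scaler0 //; apply: submodule0.
move=> a _ _ [u Uu <-] [v Uv <-]; exists (a *: u + v).
  exact: submoduleL.
by rewrite scalerDr !scalerA mulrC.
Qed.

Lemma submodule_kernel (M : lmodType R) (U : set M) b :
  submodule U -> submodule (U `&` [set u | b *: u = 0]).
Proof.
move=> sU; apply/submoduleP; split.
  by split; [apply: submodule0 | apply: scaler0].
move=> a u v [Uu bu] [Uv bv]; split; first exact: submoduleL.
by rewrite /= scalerDr scalerA mulrC -scalerA bu bv scaler0 addr0.
Qed.

Lemma submodule_torsion (M : lmodType R) (I : set R) :
  submodule [set u : M | forall a, I a -> a *: u = 0].
Proof.
apply/submoduleP; split=> [a _|c u v Iu Iv a Ia]; first exact: scaler0.
by rewrite scalerDr scalerA mulrC -scalerA Iu // Iv // scaler0 addr0.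
Qed.

Implicit Types I J p : set R.

Lemma idealM I a x : ideal I -> I x -> I (a * x).
Proof. by move=> iI; apply: (submoduleZ iI). Qed.

Lemma idealMr I a x : ideal I -> I x -> I (x * a).
Proof. by move=> iI Ix; rewrite mulrC; apply: idealM. Qed.

Lemma idealT I : ideal I -> I 1 -> I = setT.
Proof.
by move=> iI I1; apply/seteqP; split=> // a _; rewrite -[a]mulr1; apply: idealM.
Qed.

Definition adjoin I b : set R := [set x | exists i r, I i /\ x = i + r * b].

Lemma ideal_adjoin I b : ideal I -> ideal (adjoin I b).
Proof.
move=> iI; apply/submoduleP; split.
  by exists 0, 0; rewrite mul0r addr0; split; first exact: (submodule0 iI).
move=> a _ _ [i [r [Ii ->]]] [j [s [Ij ->]]].
exists (a * i + j), (a * r + s); split; first exact: (submoduleL iI).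
by rewrite /GRing.scale /=; ring.
Qed.

Lemma adjoin_sub I b : I `<=` adjoin I b.
Proof. by move=> i Ii; exists i, 0; rewrite mul0r addr0. Qed.

Lemma adjoin_mem I b : ideal I -> adjoin I b b.
Proof.
by move=> iI; exists 0, 1; rewrite mul1r add0r; split; first exact: (submodule0 iI).
Qed.

Lemma adjoinM I b c x y : ideal I -> I (b * c) ->
  adjoin I b x -> adjoin I c y -> I (x * y).
Proof.
move=> iI Ibc [i [r [Ii ->]]] [j [s [Ij ->]]].
have -> : (i + r * b) * (j + s * c) =
    (j + s * c) * i + ((r * b) * j + (r * s) * (b * c)) by ring.
by apply: (submoduleD iI); [|apply: (submoduleD iI)]; apply: idealM.
Qed.

Definition colon I c : set R := [set x | I (c * x)].

Lemma ideal_colon I c : ideal I -> ideal (colon I c).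
Proof.
move=> iI; apply/submoduleP; split.
  by rewrite /colon /= mulr0; exact: (submodule0 iI).
move=> a u v Iu Iv; rewrite /colon /= mulrDr mulrCA.
exact: (submoduleL iI).
Qed.

Lemma ideal_annihilator (M : lmodType R) (U : set M) : ideal (annihilator U).
Proof.
apply/submoduleP; split=> [x _|a u v au av x Ux]; first exact: scale0r.
by rewrite scalerDl -scalerA au // av // scaler0 addr0.
Qed.

Lemma idealr_closedP I : idealr_closed [in I] <-> ideal I /\ ~ I 1.
Proof.
rewrite /idealr_closed notin_setE; split.
  move=> [I0 I1 IL]; split=> //; split=> //.
by move=> [[I0 IL] I1]; split.
Qed.

Lemma primeP p : prime_ideal p <->
  [/\ ideal p, ~ p 1 & forall a b, p (a * b) -> p a \/ p b].
Proof.
rewrite /prime_ideal idealr_closedP /prime_idealr_closed; split.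
  move=> [[ip p1] pM]; split=> // a b pab.
  have /pM/orP : a * b \in p by rewrite in_setE.
  by rewrite !in_setE.
move=> [ip p1 pM]; split=> // a b; rewrite in_setE => /pM pab.
by apply/orP; rewrite !in_setE.
Qed.

Lemma primeX p a n : prime_ideal p -> p (a ^+ n) -> p a.
Proof.
case/primeP => _ p1 pM; elim: n => [|n IHn]; first by rewrite expr0 => /p1.
by rewrite exprS => /pM [].
Qed.

End Submodules.

(** * Primes in noetherian rings *)

Section Noetherian.
Variable R : comNzRingType.
Hypothesis noethR : noetherian R.
Implicit Types I J p : set R.

Lemma noetherian_max (F : set R -> Prop) I0 :
  (forall I, F I -> ideal I) -> F I0 ->
  exists2 I, F I & forall J, F J -> I `<=` J -> J `<=` I.
Proof.
move=> Fi F0; apply: contrapT => noMax.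
have step (I : {I | F I}) :
    {J : {I | F I} | sval I `<=` sval J /\ ~ sval J `<=` sval I}.
  case: I => I FI; apply: cid; apply: contrapT => noJ; apply: noMax.
  exists I => // J FJ IJ.
  by apply: contrapT => nJI; apply: noJ; exists (exist _ J FJ).
have [f [_ fS]] := dependent_choice step (exist _ I0 F0).
pose g n := sval (f n).
have gi n : ideal (g n) by apply: Fi; apply: svalP.
have gle n k : g n `<=` g (n + k)%N.
  elim: k => [|k IHk] x gx; first by rewrite addn0.
  by rewrite addnS; have [+ _] := fS (n + k)%N; apply; apply: IHk.
pose U : set R := [set x | exists n, g n x].
have iU : ideal U.
  apply/submoduleP; split; first by exists 0%N; exact: (submodule0 (gi _)).
  move=> a u v [n gu] [k gv]; exists (n + k)%N; apply: (submoduleL (gi _)).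
    exact: gle.
  by rewrite addnC; apply: gle.
have [s Us] := noethR iU.
have [N sN] : exists N, [set` s] `<=` g N.
  have : [set` s] `<=` U by rewrite Us; apply: sub_smallest.
  elim: s {Us} => [|x s IHs] sU; first by exists 0%N.
  have [|N sN] := IHs.
    by move=> y ys; apply: sU; rewrite /= inE ys orbT.
  have [n gx] : U x by apply: sU; rewrite /= inE eqxx.
  exists (n + N)%N => y; rewrite /= inE => /orP[/eqP->|ys]; first exact: gle.
  by rewrite addnC; apply: gle; apply: sN.
have [_ []] := fS N => x gx.
have : U x by exists N.+1.
by rewrite Us; apply: (smallest_sub _ sN).
Qed.

(** Krull's argument: an ideal maximal among those failing [Q] is prime as soon
    as [Q] passes from [I + (b)] and [I + (c)] to [I] whenever [bc] is in [I]. *)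
Lemma prime_of_failure (Q : set R -> Prop) I0 :
  Q setT ->
  (forall I b c, ideal I -> I (b * c) -> Q (adjoin I b) -> Q (adjoin I c) -> Q I) ->
  ideal I0 -> ~ Q I0 ->
  exists p, [/\ prime_ideal p, I0 `<=` p & ~ Q p].
Proof.
move=> QT QM iI0 nQ0.
have [||p [ip Ip nQp] maxp] :=
  @noetherian_max (fun I => [/\ ideal I, I0 `<=` I & ~ Q I]) I0.
- by move=> I [].
- by split.
exists p; split=> //; apply/primeP; split=> // [p1|b c pbc].
  by apply: nQp; rewrite (idealT ip p1).
have Qadj x : ~ p x -> Q (adjoin p x).
  move=> npx; apply: contrapT => nQ; apply: npx.
  apply: (maxp (adjoin p x)); last exact: adjoin_mem.
    split=> //; first exact: ideal_adjoin.
    by apply: subset_trans Ip _; apply: adjoin_sub.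
  exact: adjoin_sub.
apply: contrapT => /not_orP[npb npc]; apply: nQp.
by apply: (QM p b c) => //; apply: Qadj.
Qed.

Definition minimal_prime p : Prop :=
  prime_ideal p /\ forall q, prime_ideal q -> q `<=` p -> q = p.

(** In the localization at a minimal prime every element of the prime is
    nilpotent. *)
Lemma minimal_prime_nilpotent p a : minimal_prime p -> p a ->
  exists c n, ~ p c /\ c * a ^+ n = 0.
Proof.
move=> [pp minp] pa; apply: contrapT => noc.
have [ip p1 pM] := (primeP p).1 pp.
pose Q I := exists c n, ~ p c /\ I (c * a ^+ n).
have [||||q [pq _ nQq]] := @prime_of_failure Q [set 0].
- by exists 1, 0%N.
- move=> I b c iI Ibc [c1 [n1 [pc1 I1]]] [c2 [n2 [pc2 I2]]].
  exists (c1 * c2), (n1 + n2)%N; split; first by case/pM.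
  by rewrite exprD mulrACA; apply: adjoinM I1 I2.
- apply/submoduleP; split=> // x _ _ -> ->.
  by rewrite addr0 scaler0.
- by move=> [c [n [pc /= c0]]]; apply: noc; exists c, n.
have qp : q `<=` p.
  move=> c qc; apply: contrapT => npc; apply: nQq.
  by exists c, 0%N; rewrite mulr1.
apply: nQq; exists 1, 1%N; split=> //.
by rewrite mul1r expr1 (minp q).
Qed.

(** Let [P], the annihilator of a submodule [U], be maximal among the annihilators
    of submodules that lie inside [p]; then [P] is prime. For if [bc] kills [U] but
    [b] and [c] do not, maximality forces some [s] outside [p] to kill the kernel
    of [b] on [U], which contains [cU]; then [c] kills [sU], whose annihilator is
    again [P] by maximality. *)
Lemma coattached_below (M : lmodType R) p :
  prime_ideal p -> annihilator [set: M] `<=` p ->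
  exists2 P, Koatt M P & P `<=` p.
Proof.
case/primeP => ip p1 pM annM.
pose F I := I `<=` p /\ exists2 U : set M, submodule U & I = annihilator U.
have [||P [Pp [U sU PU]] maxP] := @noetherian_max F (annihilator [set: M]).
- by move=> _ [_ [U _ ->]]; apply: ideal_annihilator.
- split=> //; exists setT => //; exact/submoduleP.
exists P => //; split; last by exists U.
apply/primeP; split=> [|/Pp//|b c Pbc].
  by rewrite PU; apply: ideal_annihilator.
apply: contrapT => /not_orP[nPb nPc].
pose V := U `&` [set u | b *: u = 0].
have [s [Vs nps]] : exists s, annihilator V s /\ ~ p s.
  apply: contrapT => nos; apply: nPb.
  apply: (maxP (annihilator V)).
  - split; last by exists V => //; apply: submodule_kernel.
    by move=> s Vs; apply: contrapT => nps; apply: nos; exists s.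
  - by move=> a; rewrite PU => aU x [Ux _]; apply: aU.
  - by move=> x [].
have PsU x : annihilator [set s *: u | u in U] x -> P (x * s).
  by rewrite PU => xsU u Uu; rewrite -scalerA; apply: xsU; exists u.
apply: nPc; apply: (maxP (annihilator [set s *: u | u in U])).
- split; last by exists [set s *: u | u in U] => //; apply: submodule_scale.
  by move=> x /PsU/Pp/pM[].
- move=> x; rewrite PU => xU _ [u Uu <-].
  by rewrite scalerA mulrC -scalerA xU // scaler0.
- move=> _ [u Uu <-]; rewrite scalerA mulrC -scalerA; apply: Vs.
  split; first exact: submoduleZ.
  by rewrite /= scalerA; move: Pbc; rewrite PU; apply.
Qed.

End Noetherian.

(** * Powers of an ideal and the adic filtration *)

Section Powers.
Variables (R : comNzRingType) (m : set R).

Lemma ideal_exp_mem a n x : m a -> ideal_exp m n x -> ideal_exp m n.+1 (a * x).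
Proof.
by move=> ma mx /=; apply: sub_gen_smallest; exists a => //; exists x.
Qed.

Lemma ideal_expX a n : m a -> ideal_exp m n (a ^+ n).
Proof. by move=> ma; elim: n => // n IHn; rewrite exprS; apply: ideal_exp_mem. Qed.

(** The ideal [J] varies in the induction: pulling a factor out of the left power
    replaces it by a colon ideal. *)
Lemma ideal_exp_add_sub i j (J : set R) : ideal J ->
  (forall x y, ideal_exp m i x -> ideal_exp m j y -> J (x * y)) ->
  ideal_exp m (i + j) `<=` J.
Proof.
elim: i J => [|i IHi] J iJ sJ; first by move=> y my; rewrite -[y]mul1r; apply: sJ.
rewrite addSn; apply: smallest_sub => // _ [c mc [z mz <-]].
apply: (IHi (colon J c)) mz; first exact: ideal_colon.
by move=> x y mx my; rewrite /colon /= mulrA; apply: sJ => //; apply: ideal_exp_mem.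
Qed.

Definition principal (a : R) : set R := [set r * a | r in setT].

Lemma ideal_principal a : ideal (principal a).
Proof.
apply/submoduleP; split; first by exists 0; rewrite ?mul0r.
move=> r _ _ [u _ <-] [v _ <-]; exists (r * u + v) => //.
by rewrite mulrDl -mulrA.
Qed.

Lemma ideal_exp_sub_principalX a k n : ideal_exp m k `<=` principal a ->
  ideal_exp m (n * k) `<=` principal (a ^+ n).
Proof.
move=> ka; elim: n => [|n IHn]; first by move=> x _; exists x; rewrite ?mulr1.
rewrite mulSn; apply: ideal_exp_add_sub; first exact: ideal_principal.
move=> x y /ka[r _ <-] /IHn[s _ <-].
by exists (r * s); rewrite // exprS mulrACA.
Qed.

Variable M : lmodType R.

Lemma adic_submod_scale n a (u : M) : ideal_exp m n a -> adic_submod m n (a *: u).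
Proof. by move=> ma; apply: sub_gen_smallest; exists a => //; exists u. Qed.

Lemma adic_submod_le n k : (n <= k)%N -> adic_submod m k `<=` adic_submod (M := M) m n.
Proof.
move=> /subnK <-; elim: (k - n)%N => // i IHi.
by apply: subset_trans IHi; rewrite addSn; apply: adic_submodS.
Qed.

Lemma separated_notin (u : M) :
  separated m M -> u <> 0 -> exists n, ~ adic_submod m n u.
Proof.
move=> sepM u0; apply: contrapT => noN; apply: u0; suff : [set 0] u by [].
by rewrite -sepM => n _; apply: contrapT => nu; apply: noN; exists n.
Qed.

Lemma adic_submod_sub_principal n b : ideal_exp m n `<=` principal b ->
  adic_submod m n `<=` [set b *: y | y in [set: M]].
Proof.
move=> nb; apply: smallest_sub.
  by apply: submodule_scale; apply/submoduleP.
move=> _ [_ /nb[r _ <-] [y _ <-]]; exists (r *: y) => //.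
by rewrite scalerA mulrC.
Qed.

Lemma torsionfree_exp :
  (forall u : M, (forall b, m b -> b *: u = 0) -> u = 0) ->
  forall n (u : M), (forall b, ideal_exp m n b -> b *: u = 0) -> u = 0.
Proof.
move=> Mm; elim=> [|n IHn] u nu; first by rewrite -[u]scale1r; apply: nu.
apply: IHn => z mz; apply: Mm => b mb.
by rewrite scalerA; apply: nu; apply: ideal_exp_mem.
Qed.

(** * The completion as a module of coherent sequences *)

Lemma adic_proj_eq0 n (u : M) : adic_proj m n u = 0 <-> adic_submod m n u.
Proof.
have -> : adic_submod m n u = (u - 0 \in submod_pred (adic_submodule m M n)) :> Prop.
  by rewrite subr0 /submod_pred in_setE.
rewrite Quotient.idealrBE -[X in _ = X <-> _](raddf0 (adic_proj m n)).
by split=> /eqP.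
Qed.

Lemma adic_proj_eq n (u v : M) :
  adic_submod m n (u - v) -> adic_proj m n u = adic_proj m n v.
Proof. by move/adic_proj_eq0; rewrite raddfB => /subr0_eq. Qed.

Lemma adic_proj_surj n (y : adic_quot m M n) : exists u, y = adic_proj m n u.
Proof.
by exists (repr (y : Quotient.quot _)); rewrite /adic_proj reprK. Qed.

Lemma completion_eq0 (x : completion m M) :
  (forall n, completion_val x n = 0) -> x = 0.
Proof.
by move=> x0; apply/val_inj/functional_extensionality_dep.
Qed.

Lemma completion_scaleE a (x : completion m M) n :
  completion_val (a *: x) n = a *: completion_val x n.
Proof. by []. Qed.

Lemma completion_leE (x : completion m M) n k (u : M) : (n <= k)%N ->
  completion_val x k = adic_proj m k u -> completion_val x n = adic_proj m n u.
Proof.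
have /asboolP cx := valP x.
move=> /subnK <-; elim: (k - n)%N => // i IHi.
rewrite addSn => xi; apply: IHi.
by rewrite -(cx (i + n)%N) [X in adic_trans X]xi adic_transE.
Qed.

Lemma completion_lim (s : nat -> M) :
  (forall n, adic_submod m n (s n.+1 - s n)) ->
  exists x : completion m M, forall n, completion_val x n = adic_proj m n (s n).
Proof.
move=> cs; pose y : lmod_prod (adic_quot m M) := fun n => adic_proj m n (s n).
have cy : y \in coherent (I := m) (M := M).
  by apply/asboolP => n; rewrite adic_transE; apply: adic_proj_eq.
by exists (Completion cy).
Qed.

End Powers.

(** * Local rings of dimension at most one *)

Section DimensionOne.
Variables (R : comNzRingType) (m : set R).
Hypothesis noethR : noetherian R.
Hypothesis locm : local_ring m.
Hypothesis dim1 : krull_dim_le R 1.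
Implicit Types p q : set R.

Lemma local_ideal : ideal m /\ ~ m 1.
Proof. by apply/idealr_closedP; case: ((locm m).2 erefl). Qed.

Lemma prime_sub_local p : prime_ideal p -> p `<=` m.
Proof.
case/primeP => ip p1 _.
have [||J [iJ J1 pJ] maxJ] :=
  @noetherian_max _ noethR (fun I => [/\ ideal I, ~ I 1 & p `<=` I]) p.
- by move=> I [].
- by split.
suff <- : J = m by [].
apply/locm; split; first exact/idealr_closedP.
move=> K /idealr_closedP[iK K1] JK; apply/seteqP; split=> //.
by apply: maxJ => //; split=> //; apply: subset_trans JK.
Qed.

Lemma local_max (I : set R) : ideal I -> ~ I 1 -> m `<=` I -> I = m.
Proof.
move=> iI I1 mI; have [_ maxm] := (locm m).2 erefl.
by apply: maxm => //; apply/idealr_closedP.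
Qed.

Lemma annihilator_socle (M : lmodType R) (u : M) :
  (forall b, m b -> b *: u = 0) -> u <> 0 -> annihilator [set u] = m.
Proof.
move=> mu u0; apply: local_max; first exact: ideal_annihilator.
  by move=> /(_ u erefl); rewrite scale1r.
by move=> b mb _ ->; apply: mu.
Qed.

Lemma prime_local : prime_ideal m.
Proof.
have [im m1] := local_ideal.
have [||//|//|p [pp mp _]] := @prime_of_failure _ noethR (fun I => I 1) m.
- by [].
- by move=> I b c iI Ibc I1 J1; rewrite -[1]mulr1; apply: adjoinM I1 J1.
suff -> : m = p by [].
by apply/seteqP; split=> //; apply: prime_sub_local.
Qed.

Lemma local_sub_prime p : prime_ideal p -> m `<=` p -> p = m.
Proof. by move=> pp mp; apply/seteqP; split=> //; apply: prime_sub_local. Qed.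

Lemma nonmaximal_minimal p : prime_ideal p -> p <> m -> minimal_prime p.
Proof.
move=> pp pm; split=> // q pq qp; apply: contrapT => nqp.
pose c (i : nat) := if i is 0 then q else if i is 1 then p else m.
suff : (2 <= 1)%N by [].
apply: (dim1 (p := c)).
  by move=> [|[|i]] _ //; apply: prime_local.
move=> [|[|i]] // _; rewrite properEneq; split=> //.
- exact/eqP.
- exact/eqP.
- exact: prime_sub_local.
Qed.

Lemma ideal_exp_sub (I : set R) : ideal I ->
  (forall q, prime_ideal q -> I `<=` q -> q = m) ->
  exists k, ideal_exp m k `<=` I.
Proof.
move=> iI Iq; apply: contrapT => nI.
have [||//|//|q [pq Iq' nq]] :=
  @prime_of_failure _ noethR (fun J => exists k, ideal_exp m k `<=` J) I.
- by exists 0%N.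
- move=> J b c iJ Jbc [k mk] [l ml]; exists (k + l)%N.
  apply: ideal_exp_add_sub => // x y /mk Jx /ml Jy; exact: adjoinM Jx Jy.
apply: nq; exists 1%N; rewrite (Iq q) //.
have [im _] := local_ideal.
by apply: smallest_sub => // _ [b mb [r _ <-]]; apply: idealMr.
Qed.

(** Prime avoidance without counting the minimal primes: choose [a] in [m] with the
    intersection of the primes containing [a] as large as possible. If some
    nonmaximal prime [p] contains [a], then [c a^n = 0] for some [c] outside [p],
    and a prime containing [a + c] contains [a] and [c], so that [a + c] does
    better. *)
Lemma exists_parameter :
  exists2 a, m a & forall q, prime_ideal q -> q a -> q = m.
Proof.
have [im m1] := local_ideal.
pose rad a : set R := [set x | forall q, prime_ideal q -> q a -> q x].
have [||_ [a ma ->] maxa] :=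
  @noetherian_max _ noethR (fun I => exists2 a, m a & I = rad a) (rad 0).
- move=> _ [a _ ->]; apply/submoduleP; split=> [q|r u v ru rv q] pq qa.
    by case/primeP: pq => iq _ _; exact: (submodule0 iq).
  have [iq _ _] := (primeP q).1 pq.
  by apply: (submoduleL iq); [apply: ru|apply: rv].
- by exists 0 => //; exact: (submodule0 im).
exists a => // p pp pa; apply: contrapT => npm.
have minp := nonmaximal_minimal pp npm.
have [c0 [n [npc0 c0a]]] := minimal_prime_nilpotent noethR minp pa.
(* [c0] need not lie in [m]; its product with an element of [m] outside [p] does *)
have [d md npd] : exists2 d, m d & ~ p d.
  apply: contrapT => nod; apply: npm; apply: local_sub_prime => // d md.
  by apply: contrapT => npd; apply: nod; exists d.
have [ip p1 pM] := (primeP p).1 pp.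
have npc : ~ p (c0 * d) by case/pM.
have ac q : prime_ideal q -> q (a + c0 * d) -> q a.
  move=> pq qac; have [iq _ _] := (primeP q).1 pq.
  apply: (primeX (n := n.+1)) => //.
  have -> : a ^+ n.+1 = a ^+ n * (a + c0 * d).
    by rewrite mulrDr -exprSr mulrA [a ^+ n * c0]mulrC c0a mul0r addr0.
  exact: idealM.
(* [c0 d] lies in every prime containing [a + c0 d]; maximality would put it into
   every prime containing [a], in particular into [p] *)
apply: npc; apply: (maxa (rad (a + c0 * d))) pa => //.
- exists (a + c0 * d) => //; apply: (submoduleD im) => //.
  exact: idealM.
- by move=> x ax q pq qac; apply: ax => //; apply: ac.
- move=> q pq qac; have [iq _ _] := (primeP q).1 pq.
  rewrite -[c0 * d](addKr a) addrC; apply: (submoduleB iq) => //.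
  exact: ac.
Qed.

(** * Associated primes of the completion *)

Variable M : lmodType R.

(** The ideal [(a)] of a parameter [a] contains some [m^k]; as no nonzero element
    of [M] is killed by a power of [m], multiplication by [a] is injective on [M].
    Hence [a u] in [m^((n+1)k) M], which lies in [a^(n+1) M], forces [u] into
    [a^n M]. *)
Lemma torsionfree_completion :
  (forall u : M, (forall b, m b -> b *: u = 0) -> u = 0) ->
  forall x : completion m M, (forall b, m b -> b *: x = 0) -> x = 0.
Proof.
move=> Mm x mx.
have [a ma aq] := exists_parameter.
have [|q pq aq'|k ka] := @ideal_exp_sub (principal a).
- exact: ideal_principal.
- by apply: aq => //; apply: aq'; exists 1; rewrite ?mul1r.
have rega (u : M) : a *: u = 0 -> u = 0.
  move=> au; apply: (torsionfree_exp Mm (n := k)) => b /ka[r _ <-].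
  by rewrite -scalerA au scaler0.
apply: completion_eq0 => n.
pose N := (n.+1 * k + n)%N.
have [u xu] := adic_proj_surj (completion_val x N).
have xn := completion_leE (leq_addl _ _ : n <= N)%N xu.
have xk := completion_leE (leq_addr _ _ : n.+1 * k <= N)%N xu.
have : adic_submod m (n.+1 * k) (a *: u).
  by apply/adic_proj_eq0; rewrite linearZ /= -xk -completion_scaleE mx.
have ka' := ideal_exp_sub_principalX (n := n.+1) ka.
case/(adic_submod_sub_principal ka') => y _ yu.
have -> : completion_val x n = adic_proj m n (a ^+ n *: y).
  rewrite xn; congr adic_proj; apply/esym/subr0_eq/rega.
  by rewrite scalerBr scalerA -exprS yu subrr.
by apply/adic_proj_eq0; apply: adic_submod_scale; apply: ideal_expX.
Qed.

Lemma Ass_completion_sub : Ass (completion m M) `<=` Koatt M.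
Proof.
move=> p [pp [x px]].
have [|P KP Pp] := coattached_below noethR (M := M) pp.
  move=> r rM; rewrite px => _ ->; apply: completion_eq0 => n.
  have [u xu] := adic_proj_surj (completion_val x n).
  by rewrite completion_scaleE xu -[LHS]linearZ rM // raddf0.
have [<- //|nPp] := eqVneq P p.
have pm : p = m.
  apply: contrapT => /(nonmaximal_minimal pp)[_ /(_ P)] minp.
  by move/eqP: nPp; apply; apply: minp => //; case: KP.
split=> //; exists [set u : M | forall b, m b -> b *: u = 0].
  exact: submodule_torsion.
have [im m1] := local_ideal.
apply/seteqP; split=> [b|b bM]; rewrite {1}pm.
  by move=> mb u; apply.
have socle : exists2 u : M, (forall b, m b -> b *: u = 0) & u <> 0.
  apply: contrapT => noS.
  have x0 : x = 0.
    apply: torsionfree_completion.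
      move=> u mu; apply: contrapT => u0; apply: noS; exists u => //.
    move=> c mc; have : p c by rewrite pm.
    by rewrite px; apply.
  apply: m1; suff : p 1 by rewrite pm.
  by rewrite px => _ ->; rewrite x0 scaler0.
have [u mu u0] := socle.
by rewrite -(annihilator_socle mu u0) => _ ->; apply: bM.
Qed.

(** Partial sums [s_n] of a series in [U], with [s_(n+1) - s_n] in
    [m^(N_n) M] where [N_n] is so large that [a^n s_n] is nonzero modulo
    [m^(N_n) M]; their limit is then not killed by [a^n]. At each step the next
    term is [0] if [a^(n+1)] does not kill [s_n]; otherwise it is a multiple
    [a^(N_n) v] that [a^(n+1)] does not kill, which exists because no power of [a]
    kills [U]. *)
Lemma nontorsion_partial_sums (U : set M) a :
  separated m M -> submodule U -> m a ->
  (forall n, exists2 u, U u & a ^+ n *: u <> 0) ->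
  exists s N, forall n,
    [/\ U (s n), ~ adic_submod m (N n) (a ^+ n *: s n), (n <= N n)%N,
        (N n <= N n.+1)%N & adic_submod m (N n) (s n.+1 - s n)].
Proof.
move=> sepM sU ma aU.
(* a state records the index [n], the sum [s_n] and the precision [N_n] *)
pose good (t : nat * M * nat) := let: (n, s, N) := t in
  [/\ U s, ~ adic_submod m N (a ^+ n *: s) & (n <= N)%N].
pose next (t t' : nat * M * nat) :=
  let: (n, s, N) := t in let: (n', s', N') := t' in
  [/\ n' = n.+1, (N <= N')%N & adic_submod m N (s' - s)].
have refine n s N : U s ->
    exists t', good t' /\ next (n, s, N) t'.
  move=> Us; have [v Uv sv] : exists2 v, U v & a ^+ n.+1 *: (s + a ^+ N *: v) <> 0.
    have [s0|s0] := pselect (a ^+ n.+1 *: s = 0).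
      have [v Uv av] := aU (n.+1 + N)%N; exists v => //.
      by rewrite scalerDr s0 add0r scalerA -exprD.
    by exists 0; [exact: submodule0 | rewrite scaler0 addr0].
  have [N' sN'] := separated_notin sepM sv.
  exists (n.+1, s + a ^+ N *: v, maxn (maxn N n.+1) N'); split; split=> //.
  - by apply: submoduleD => //; apply: submoduleZ.
  - by move/(adic_submod_le (leq_maxr _ _)).
  - by rewrite leq_max leq_maxr.
  - by rewrite leq_max leq_maxl.
  - by rewrite addrC addKr; apply: adic_submod_scale; apply: ideal_expX.
have step (t : {t | good t}) : {t' : {t | good t} | next (sval t) (sval t')}.
  case: t => -[[n s] N] gt; apply: cid.
  have [Us _ _] := gt; have [t' [gt' nt']] := refine n s N Us.
  by exists (exist _ t' gt').
have [t0 gt0 t00] : exists2 t0, good t0 & t0.1.1 = 0%N.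
  have [u Uu u0] := aU 0%N; rewrite expr0 in u0.
  have [N uN] := separated_notin sepM u0.
  by exists (0%N, u, N) => //; split.
have [f [f0 fS]] := dependent_choice step (exist _ t0 gt0).
have fn n : (sval (f n)).1.1 = n.
  elim: n => [|n IHn]; first by rewrite f0.
  move: (fS n) IHn; case: (sval (f n)) => -[k s] N.
  by case: (sval (f n.+1)) => -[k' s'] N' [-> _ _] /= ->.
exists (fun n => (sval (f n)).1.2), (fun n => (sval (f n)).2) => n.
move: (fS n) (fn n) (svalP (f n)).
case: (sval (f n)) => -[k s] N; case: (sval (f n.+1)) => -[k' s'] N' /=.
by move=> [_ NN' ss'] -> [Us nN nlN].
Qed.

Lemma Koatt_sub_Ass_completion : separated m M -> Koatt M `<=` Ass (completion m M).
Proof.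
move=> sepM p [pp [U sU pU]]; split=> //.
have [im m1] := local_ideal.
have [ip p1 pM] := (primeP p).1 pp.
have [pm|npm] := eqVneq p m.
  have [u Uu u0] : exists2 u, U u & u <> 0.
    apply: contrapT => noU; apply: p1; rewrite pU => u Uu.
    by rewrite scale1r; apply: contrapT => u0; apply: noU; exists u.
  have [n nu] := separated_notin sepM u0.
  have [|x xu] := @completion_lim _ m M (fun=> u).
    by move=> k; rewrite subrr; apply: submodule0; apply: adic_submodule.
  exists x; rewrite {1}pm; apply/esym/local_max; first exact: ideal_annihilator.
    move=> /(_ x erefl); rewrite scale1r => x0; apply: nu.
    by apply/adic_proj_eq0; rewrite -xu x0.
  move=> b mb _ ->; apply: completion_eq0 => k; rewrite completion_scaleE xu.
  have pb : annihilator U b by rewrite -pU pm.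
  by rewrite -[LHS]linearZ pb // raddf0.
have [a ma npa] : exists2 a, m a & ~ p a.
  apply: contrapT => noa; move/eqP: npm; apply; apply: local_sub_prime => // a ma.
  by apply: contrapT => npa; apply: noa; exists a.
have [n|s [N sN]] := nontorsion_partial_sums sepM sU ma.
  apply: contrapT => noU; apply: npa; apply: (primeX (n := n)) => //.
  by rewrite pU => u Uu; apply: contrapT => au; apply: noU; exists u.
have [|x xs] := @completion_lim _ m M s.
  move=> n; have [_ _ nN _ ss] := sN n.
  exact: adic_submod_le ss.
have tail n i : (N n <= N (n + i))%N /\ adic_submod m (N n) (s (n + i)%N - s n).
  elim: i => [|i [NN IHi]].
    by rewrite addn0 subrr; split=> //; apply: submodule0; apply: adic_submodule.
  rewrite addnS; have [_ _ _ NS sS] := sN (n + i)%N; split; first exact: leq_trans NS.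
  rewrite -(subrKA (s (n + i)%N)); apply: submoduleD IHi; first exact: adic_submodule.
  exact: adic_submod_le sS.
have xN n : completion_val x (N n) = adic_proj m (N n) (s n).
  have [_ _ nN _ _] := sN n.
  rewrite xs; apply: adic_proj_eq; rewrite -[X in s X](subnKC nN).
  by have [] := tail n (N n - n)%N.
have px b : p b -> b *: x = 0.
  rewrite pU => pb; apply: completion_eq0 => k; rewrite completion_scaleE xs.
  have [Us _ _ _ _] := sN k.
  by rewrite -[LHS]linearZ pb // raddf0.
exists x; apply/seteqP; split=> [b /px bx _ -> //|b /(_ x erefl) bx].
(* every prime containing [p] and [b] strictly contains [p], hence is [m] *)
apply: contrapT => npb.
have [|q pq bq|k kpb] := @ideal_exp_sub (adjoin p b).
- exact: ideal_adjoin.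
- apply: contrapT => /(nonmaximal_minimal pq)[_ /(_ p pp)] minq.
  apply: npb; rewrite minq; first by apply: bq; apply: adjoin_mem.
  by apply: subset_trans bq; apply: adjoin_sub.
have [i [r [pi akE]]] := kpb _ (ideal_expX k ma).
have [_ + _ _ _] := sN k; apply.
apply/adic_proj_eq0; rewrite linearZ /= -xN -completion_scaleE.
by rewrite akE scalerDl -scalerA bx px // scaler0 addr0.
Qed.

End DimensionOne.
End CompletionPrimes.

Theorem mainTheorem1 (R : comNzRingType) (m : set R) (M : lmodType R) :
  noetherian R -> local_ring m -> krull_dim_le R 1 ->
  separated m M ->
  Ass (completion m M) = Koatt M.
Proof.
move=> noethR locm dim1 sepM; apply/seteqP; split.
  exact: Ass_completion_sub.
exact: Koatt_sub_Ass_completion.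
Qed.
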